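(* For $n\ge0$, $\mathrm{WI}_n=\sum_{k\ge0}2^kR_{n,k}$, where $\mathrm{WI}_n$ and $R_{n,k}$ are defined in the context.
   Context: For $n\ge1$, $S_n$ is the set of permutations of $\{0,\dots,n-1\}$ in one-line notation. $S^3_n$ is the set of pairs $\Pi=(\pi^2,\pi^3)$ of elements of $S_n$ (for $n=0$, the empty permutation); its elements are the columns $\Pi_j=(\pi^2_j,\pi^3_j)^T$ with level $\mathrm{lev}(\Pi_j)=\max\{\pi^2_j,\pi^3_j\}$. $\Pi$ is canonical if $\pi^2=01\cdots(n-1)$. $R_{n,k}$ is the number of canonical $\Pi\in S^3_n$ in which exactly $k$ distinct level values are each attained by two elements. $\mathrm{WI}_n$ is the number of $\Pi\in S^3_n$ with $\mathrm{lev}(\Pi_1)\le\mathrm{lev}(\Pi_2)\le\dots\le\mathrm{lev}(\Pi_n)$. *)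

(* Defs.v *)
From mathcomp Require Import all_boot all_order all_algebra all_fingroup.
From mathcomp Require Import classical_sets cardinality fsbigop.

Set Implicit Arguments.
Unset Strict Implicit.
Unset Printing Implicit Defensive.

(* A pair (pi^2, pi^3); its columns are indexed by j : 'I_n. *)
Definition perm3 (n : nat) : finType := ('S_n * 'S_n)%type.

Definition lev (n : nat) (Pi : perm3 n) (j : 'I_n) : nat :=
  maxn (Pi.1 j) (Pi.2 j).

(* pi^2 = 0 1 ... (n-1) in one-line notation. *)
Definition canonical (n : nat) (Pi : perm3 n) : bool :=
  [forall j : 'I_n, Pi.1 j == j].

(* Levels are < n, so all possible level values are in 'I_n. *)
Definition double_levels (n : nat) (Pi : perm3 n) : {set 'I_n} :=
  [set v : 'I_n | #|[set j : 'I_n | lev Pi j == v]| == 2].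

Definition Rnk (n k : nat) : nat :=
  #|[set Pi : perm3 n | canonical Pi & #|double_levels Pi| == k]|.

Definition WI (n : nat) : nat :=
  #|[set Pi : perm3 n | sorted leq [seq lev Pi j | j <- enum 'I_n]]|.

Lemma Rnk_eq0 (n k : nat) : n < k -> Rnk n k = 0.
Proof.
move=> lt_nk; apply/eqP; rewrite cards_eq0; apply/eqP/setP => Pi.
rewrite !inE; apply/negbTE/negP => /andP[_ /eqP dk].
by have := max_card (mem (double_levels Pi)); rewrite dk card_ord leqNgt lt_nk.
Qed.

(* The big operator over a classical set is 0 by convention when the support is
   infinite; this is never the case for the sum of the 2 ^ k * Rnk n k. *)
Lemma finite_support_Rnk (n : nat) :
  finite_set [set k : nat | 2 ^ k * Rnk n k <> 0]%classic.
Proof.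
apply: (@sub_finite_set _ _ `I_n.+1) => [k /= nz|]; last exact: finite_II.
by rewrite ltnS leqNgt; apply/negP => /Rnk_eq0 Rk0; apply: nz; rewrite Rk0 muln0.
Qed.

(* Main.v *)
(** Reordering the columns of Pi makes every pair of permutations equal to
    [(r, r * c)] for a unique canonical pair [(1, c)] and a unique [r], and the
    levels of [(r, r * c)] are those of [(1, c)] composed with [r].  The
    permutations [r] sorting these levels form a coset of the stabiliser of the
    level function.  A level [v] is attained only where [pi^2] or [pi^3] is [v],
    hence at most twice, so the stabiliser is generated by the swaps of the two
    elements of each double level and has order [2 ^ k]. *)
Require Import Defs.
From mathcomp Require Import all_boot all_order all_algebra all_fingroup.
From mathcomp Require Import classical_sets cardinality fsbigop.

Set Implicit Arguments.
Unset Strict Implicit.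
Unset Printing Implicit Defensive.

Section FiberSwaps.
Variables (T V : finType) (f : T -> V).

Definition fiber (v : V) : {set T} := [set j | f j == v].

Definition double_values : {set V} := [set v | #|fiber v| == 2].

(** When fibers have at most two elements the pick has no choice. The default [j] makes the only
    element of a singleton fiber its own partner, so this is a total involution. *)
Definition partner (j : T) : T := odflt j [pick k in fiber (f j) | k != j].

Definition swap_fibers (D : {set V}) (j : T) : T :=
  if f j \in D then partner j else j.

Lemma f_partner j : f (partner j) = f j.
Proof. by rewrite /partner; case: pickP => // k; rewrite inE => /andP[/eqP]. Qed.

Lemma f_swap_fibers D j : f (swap_fibers D j) = f j.
Proof. by rewrite /swap_fibers; case: ifP => // _; exact: f_partner. Qed.

Hypothesis fiber_le2 : forall v, #|fiber v| <= 2.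

Lemma fiber_two {x y z} : f y = f x -> f z = f x -> y != x -> z != x -> y = z.
Proof.
move=> fy fz yx zx; apply/eqP/negPn/negP => yz.
have: #|[set x; y; z]| <= #|fiber (f x)|.
  by apply/subset_leq_card/fintype.subsetP => w;
     rewrite !inE => /orP[/orP[]|] /eqP ->; rewrite ?fy ?fz.
move/leq_trans => /(_ _ (fiber_le2 _)).
rewrite -finset.setUA cardsU1 cards2 yz !inE negb_or.
by rewrite ![x == _]eq_sym yx zx.
Qed.

Lemma partner_eq j k : f k = f j -> k != j -> partner j = k.
Proof.
move=> fk kj; rewrite /partner; case: pickP => [l|/(_ k)]; last first.
  by rewrite inE fk eqxx kj.
by rewrite inE => /andP[/eqP fl lj]; exact: fiber_two fl fk lj kj.
Qed.

Lemma partnerK : involutive partner.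
Proof.
move=> j; have [jj|] := eqVneq (partner j) j; first by rewrite !jj.
by rewrite eq_sym => nj; apply: partner_eq; rewrite ?f_partner.
Qed.

Lemma partner_double j : (partner j != j) = (f j \in double_values).
Proof.
rewrite inE; apply/idP/eqP => [pj|].
  apply/eqP; rewrite eqn_leq fiber_le2 -(_ : #|[set partner j; j]| = 2).
    apply/subset_leq_card/fintype.subsetP => w.
    by rewrite !inE => /orP[] /eqP ->; rewrite ?f_partner.
  by rewrite cards2 pj.
move/eqP/cards2P => [x [y [xy Fj]]].
have fx : f x = f j by apply/eqP; have := set21 x y; rewrite -Fj inE.
have fy : f y = f j by apply/eqP; have := set22 x y; rewrite -Fj inE.
have [jx|jx] := eqVneq x j; last by rewrite (partner_eq fx jx).
by rewrite (partner_eq fy) // -jx eq_sym.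
Qed.

Lemma swap_fibersK D : involutive (swap_fibers D).
Proof.
by move=> j; case fD: (f j \in D); rewrite /swap_fibers fD ?f_partner fD ?partnerK.
Qed.

Definition swap_perm (D : {set V}) : {perm T} :=
  perm (can_inj (swap_fibersK D)).

Definition stab_fun : {set {perm T}} :=
  [set q : {perm T} | [forall j, f (q j) == f j]].

(** [swap_perm] is a bijection from the subsets of [double_values] onto the stabiliser: an element
    of the stabiliser can only send a point to itself or to its partner. *)
Lemma card_stab_fun : #|stab_fun| = 2 ^ #|double_values|.
Proof.
rewrite -card_powerset -(card_in_imset (f := swap_perm)).
  congr #|pred_of_set _|; apply/setP => q; rewrite inE.
  apply/forallP/imsetP => [fq|[D _ ->] j]; last by rewrite permE f_swap_fibers.
  (* The set to swap consists of the values whose fibers [q] moves. *)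
  exists (f @: [set j | q j != j]).
    rewrite inE; apply/fintype.subsetP => _ /imsetP[j qj ->].
    move: qj; rewrite inE => qj.
    by rewrite -partner_double (partner_eq (eqP (fq j)) qj).
  apply/permP => j; rewrite permE /swap_fibers.
  case: imsetP => [[k]|nD].
    rewrite inE => qk fjk.
    have [jk|jk] := eqVneq j k.
      by rewrite jk (partner_eq (eqP (fq k)) qk).
    (* [j] and [k] fill their fiber and [q] moves [k], so [q k = j]; by injectivity [q] then moves
       [j] too. *)
    have qkj : q k = j by exact: fiber_two (eqP (fq k)) fjk qk jk.
    suff qj : q j != j by rewrite (partner_eq (eqP (fq j)) qj).
    by rewrite -{2}qkj (inj_eq perm_inj).
  by apply/eqP/negPn/negP => qj; apply: nD; exists j; rewrite ?inE.
move=> D E; rewrite !inE => /fintype.subsetP sD /fintype.subsetP sE /permP DE.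
(* For injectivity, [B] is recovered on double values from the points that [swap_perm B] moves. *)
have mem_swap (B : {set V}) j : f j \in double_values ->
    (f j \in B) = (swap_perm B j != j).
  rewrite permE /swap_fibers -partner_double => pj.
  by case: ifP => _; rewrite ?pj ?eqxx.
have eqDE v : v \in double_values -> (v \in D) = (v \in E).
  move=> dv; have /card_gt0P[j] : 0 < #|fiber v|.
    by move: dv; rewrite inE => /eqP ->.
  rewrite inE => /eqP fj; move: dv; rewrite -fj => dv.
  by rewrite (mem_swap D j dv) (mem_swap E j dv) DE.
apply/setP => v; have [dv|ndv] := boolP (v \in double_values); first exact: eqDE.
by rewrite (contraNF (sD v) ndv) (contraNF (sE v) ndv).
Qed.

End FiberSwaps.

(** A sorted list is determined by its multiset, so every sorting [r] yields the same list as one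
    fixed [r0]. The sorting permutations thus form the translate of [stab_fun f] by [r0]. *)
Lemma card_sorting_perms n (f : 'I_n -> 'I_n) :
  #|[set r : 'S_n | sorted leq [seq val (f (r j)) | j <- enum 'I_n]]|
  = #|stab_fun f|.
Proof.
pose L (r : 'S_n) := [seq val (f (r j)) | j <- enum 'I_n].
pose t := [tuple val (f j) | j < n].
have permL r : perm_eq (L r) t.
  apply/tuple_permP; exists r; apply: eq_map => j.
  by rewrite tnth_mktuple.
have /tuple_permP[r0 sr0] : perm_eq (sort leq t) t by rewrite perm_sort.
have {}sr0 : sorted leq (L r0).
  have -> : L r0 = sort leq t.
    by rewrite sr0; apply: eq_map => j; rewrite tnth_mktuple.
  exact/sort_sorted/leq_total.
have sortedL r : sorted leq (L r) = [forall j, f (r j) == f (r0 j)].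
  apply/idP/forallP => [sr j|fr].
    have /eq_in_map/(_ j) : L r = L r0.
      apply: (sorted_eq leq_trans anti_leq sr sr0).
      by rewrite (perm_trans (permL r)) // perm_sym permL.
    by rewrite mem_enum => /(_ isT)/val_inj ->.
  suff -> : L r = L r0 by [].
  by apply: eq_map => j; rewrite (eqP (fr j)).
rewrite -(card_imset (stab_fun f) (mulgI r0)); congr #|pred_of_set _|.
apply/setP => r; rewrite inE [LHS]sortedL.
apply/forallP/imsetP => [fr|[q]].
  exists (r0^-1 * r)%g; last by rewrite mulKVg.
  by rewrite inE; apply/forallP => j; rewrite permM (eqP (fr _)) permKV.
by rewrite inE => /forallP fq -> j; rewrite permM fq.
Qed.

Section Levels.
Variable n : nat.

Lemma lev_lt (Pi : perm3 n) j : lev Pi j < n.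
Proof. by rewrite gtn_max !ltn_ord. Qed.

Definition ord_lev (Pi : perm3 n) j : 'I_n := Ordinal (lev_lt Pi j).

Lemma fiber_ord_lev_le2 Pi v : #|fiber (ord_lev Pi) v| <= 2.
Proof.
apply: leq_trans (_ : #|[set (Pi.1^-1)%g v; (Pi.2^-1)%g v]| <= 2).
  apply/subset_leq_card/fintype.subsetP => j; rewrite !inE -val_eqE /= /lev.
  case: (leqP (Pi.1 j) (Pi.2 j)) => _ /eqP/val_inj <-;
    by rewrite permK eqxx ?orbT.
by rewrite cards2; case: (_ != _).
Qed.

Lemma double_levelsE Pi : double_levels Pi = double_values (ord_lev Pi).
Proof. by []. Qed.

Lemma WI_canonical :
  WI n = \sum_(c : 'S_n) 2 ^ #|double_levels ((1%g, c) : perm3 n)|.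
Proof.
rewrite /WI -sum1_card.
under eq_bigl do rewrite inE.
rewrite big_mkcond /=.
rewrite -(pair_bigA _ (fun r t : 'S_n => if sorted leq
  [seq lev ((r, t) : perm3 n) j | j <- enum 'I_n] then 1 else 0)) /=.
(* Substitute [t = r * c]. Since [(r * c) j = c (r j)], the level of the pair at [j] is that of
   [(1, c)] at [r j], and for fixed [c] the sum counts sorting permutations [r]. *)
under eq_bigr => r _ do rewrite (reindex_inj (mulgI r)) /=.
rewrite exchange_big; apply: eq_bigr => c _.
rewrite double_levelsE -card_stab_fun; last exact: fiber_ord_lev_le2.
rewrite -card_sorting_perms -sum1_card -big_mkcond.
apply: eq_bigl => r; rewrite inE; congr sorted.
by apply: eq_map => j; rewrite /= /lev /= !permE.
Qed.

Lemma sum_Rnk :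
  \sum_(k < n.+1) 2 ^ k * Rnk n k
  = \sum_(c : 'S_n) 2 ^ #|double_levels ((1%g, c) : perm3 n)|.
Proof.
(* There are at most [n] double levels, so [inord] does not alter the count. *)
pose d (Pi : perm3 n) : 'I_n.+1 := inord #|double_levels Pi|.
have dE Pi : d Pi = #|double_levels Pi| :> nat.
  by rewrite inordK // ltnS -[leqRHS](card_ord n) max_card.
transitivity (\sum_(Pi : perm3 n | canonical Pi) 2 ^ #|double_levels Pi|).
  rewrite (partition_big d xpredT) //=; apply: eq_bigr => k _.
  rewrite mulnC -sum_nat_const; symmetry.
  apply: eq_big => [Pi|Pi /andP[_ /eqP <-]]; last by rewrite dE.
  by rewrite inE -val_eqE /= dE.
rewrite (reindex_onto (fun c : 'S_n => (1%g, c) : perm3 n) snd) /=.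
  apply: eq_bigl => c; rewrite eqxx andbT.
  by apply/forallP => j; rewrite perm1.
move=> [s c] /forallP /= s1; congr (_, _).
by apply/permP => j; rewrite perm1 (eqP (s1 j)).
Qed.

End Levels.

Theorem theorem3p8 (n : nat) :
  WI n = (\sum_(k \in [set: nat]%classic) (2 ^ k * Rnk n k)%N)%R.
Proof.
rewrite WI_canonical -sum_Rnk.
(* Truncating to [k <= n] drops only zero terms, by [Rnk_eq0]. *)
rewrite -(fsbig_widen `I_n.+1) //; first by rewrite -fsbig_ord.
move=> k [_ /= nk]; rewrite Rnk_eq0 ?muln0 // ltnNge -ltnS.
exact/negP.
Qed.
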